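(* Let $n\ge 3$, $q=\frac{2n}{n-2}$, $\kappa=\frac{n-1}{n}$. Identify $S^1$ with $[-\pi,\pi]$ with endpoints identified, and let $\lambda=-1$ on $(-\pi,0)$, $\lambda=1$ on $(0,\pi)$. For $t\in\mathbb{R}$ let $\tau_t=t+\lambda$. Let $N$ be a smooth positive function on $S^1$, let $\gamma_N=-\frac{\int_{S^1}\lambda N}{\int_{S^1}N}$, and let $\eta,\mu\in\mathbb{R}$. Consider the system $$-2\kappa q\,\phi''-2\eta^2\phi^{-q-1}-\kappa\Big(\mu+\tfrac{1}{2N}w'\Big)^2\phi^{-q-1}+\kappa\tau_t^2\phi^{q-1}=0,\qquad \Big(\tfrac{1}{2N}w'\Big)'-\phi^q\tau_t'=0$$ on $S^1$. Suppose $t=\gamma_N$. If $\mu=\eta=0$, there exists a one-parameter family of solutions. If $\mu=0$ and $\eta\neq0$, there does not exist a solution.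
   Context: Here $\tau_t'=2(\delta_0-\delta_\pi)$ is the distributional derivative ($\delta_x$ the Dirac mass at $x$), and the second equation is understood in the sense of distributions. A solution is a pair $(\phi,w)\in W^{2,p}_+(S^1)\times W^{1,p}(S^1)$ for some $p>1$, where the subscript $+$ denotes positive functions. Solutions differing only by adding a constant to $w$ are regarded as the same. *)

(* Defs.v *)
(* Functions on S^1 are represented as
   2*pi-periodic2pi functions R -> R; integrals over S^1 are Lebesgue
   integrals over [-pi, pi]. *)
From HB Require Import structures.
From mathcomp Require Import all_boot all_order all_algebra.
From mathcomp Require Import all_classical all_reals all_analysis.
Set Implicit Arguments. Unset Strict Implicit. Unset Printing Implicit Defensive.
Import Order.TTheory GRing.Theory Num.Theory.
Import numFieldNormedType.Exports.
Local Open Scope classical_set_scope.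
Local Open Scope ring_scope.

Section S1Defs.
Variable R : realType.

Definition S1 : set R := `[(- pi)%R, pi]%classic.

Definition periodic2pi (f : R -> R) := forall x, f (x + 2 * pi) = f x.

Definition iderive (k : nat) (f : R -> R) : R -> R := iter k (@derive1 R R) f.

Definition smooth (f : R -> R) :=
  forall k x, derivable (iderive k f) x 1.

Definition test_fun (psi : R -> R) := smooth psi /\ periodic2pi psi.

Definition S1int (f : R -> R) : R := Rintegral (@lebesgue_measure R) S1 f.

Definition Lp (p : R) (f : R -> R) :=
  measurable_fun S1 f /\
  (\int[@lebesgue_measure R]_(x in S1) ((`|f x| `^ p)%:E) < +oo)%E.

Definition weak_deriv (f g : R -> R) :=
  forall psi, test_fun psi ->
    S1int (fun x => f x * (derive1 psi) x) = - S1int (fun x => g x * psi x).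

Definition W1p (p : R) (f : R -> R) :=
  periodic2pi f /\ Lp p f /\ exists g, periodic2pi g /\ Lp p g /\ weak_deriv f g.

Definition W2p (p : R) (f : R -> R) :=
  periodic2pi f /\ Lp p f /\ exists g1 g2, periodic2pi g1 /\ periodic2pi g2 /\
    Lp p g1 /\ Lp p g2 /\ weak_deriv f g1 /\ weak_deriv g1 g2.

(* lambda = -1 on (-pi,0), 1 on (0,pi) (extended periodically; the values
   at 0 and pi are irrelevant) *)
Definition lam (x : R) : R := if sin x < 0 then -1 else 1.

Definition tau (t x : R) : R := t + lam x.

Definition qexp (n : nat) : R := (2 * n%:R) / (n%:R - 2).
Definition kappa (n : nat) : R := (n%:R - 1) / n%:R.

Definition gammaN (N : R -> R) : R := - (S1int (fun x => lam x * N x) / S1int N).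

(* (phi, w) is a solution of the system, with parameters n, N, eta, mu, t:
   phi in W^{2,p}_+(S^1), w in W^{1,p}(S^1) for some p > 1,
   phi taken as its continuous representative;
   first equation holds a.e. (phi'' and w' in L^p),
   second equation in the sense of distributions, with
   tau_t' = 2 (delta_0 - delta_pi). *)
Definition is_solution (n : nat) (N : R -> R) (eta mu t : R)
    (phi w : R -> R) :=
  let q := qexp n in let k := kappa n in
  exists p : R, 1 < p /\
  periodic2pi phi /\ periodic2pi w /\ continuous phi /\ (forall x, 0 < phi x) /\
  Lp p phi /\ Lp p w /\
  exists phi1 phi2 w1 : R -> R,
    periodic2pi phi1 /\ periodic2pi phi2 /\ periodic2pi w1 /\
    Lp p phi1 /\ Lp p phi2 /\ Lp p w1 /\
    weak_deriv phi phi1 /\ weak_deriv phi1 phi2 /\ weak_deriv w w1 /\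
    {ae @lebesgue_measure R, forall x, S1 x ->
       - 2 * k * q * phi2 x
       - 2 * eta ^+ 2 * phi x `^ (- q - 1)
       - k * (mu + w1 x / (2 * N x)) ^+ 2 * phi x `^ (- q - 1)
       + k * (tau t x) ^+ 2 * phi x `^ (q - 1) = 0} /\
    (forall psi, test_fun psi ->
       - S1int (fun x => w1 x / (2 * N x) * derive1 psi x)
       - 2 * (phi 0 `^ q * psi 0 - phi pi `^ q * psi pi) = 0).

End S1Defs.

(* Main.v *)
(* With mu = 0 put u = w' / (2 N). The second equation says that u jumps by
   2 phi(0)^q at 0 and by -2 phi(pi)^q at pi, so by du Bois-Reymond's lemma
   phi(0) = phi(pi) and u = phi(0)^q lambda + s almost everywhere; since w' has
   mean zero, s = phi(0)^q gamma_N, that is u = phi(0)^q tau. If eta = 0 every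
   positive constant phi is therefore a solution. If eta <> 0, the first equation
   reads
     2 kappa q phi'' = - phi^(-q-1) (2 eta^2 + kappa tau^2 (phi(0)^(2q) - phi^(2q))),
   so that phi'' is bounded above by a negative constant near a minimum of phi,
   where phi <= phi(0). This is impossible; as phi'' is only a weak derivative,
   the maximum principle is applied to the averages of phi against the kernels
   ((1 + cos(x - x0)) / 2)^k. *)
Require Import Defs.
From HB Require Import structures.
From mathcomp Require Import all_boot all_order all_algebra.
From mathcomp Require Import all_classical all_reals all_analysis.
From mathcomp Require Import measurable_realfun.
From mathcomp Require Import ring lra.
Set Implicit Arguments. Unset Strict Implicit. Unset Printing Implicit Defensive.
Import Order.TTheory GRing.Theory Num.Theory.
Import numFieldNormedType.Exports.
Local Open Scope classical_set_scope.
Local Open Scope ring_scope.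

(** * Explicit test functions *)

(** Weak derivatives are never upgraded to classical ones. Both analytic arguments test against
    explicit functions built from sine, cosine, exponentials and inverses, so smoothness and
    periodicity come by construction and integration by parts over the circle leaves no boundary
    term. For du Bois-Reymond's lemma, a logistic function of a trigonometric polynomial
    approximates the indicator of an arc. For the maximum principle, c = (1 + cos(x - x0)) / 2 is
    chosen because c'^2 and c'' are polynomials in c, so the second derivative of c^(k+1) is a
    combination of c^k and c^(k+1) alone. An equation f'' = g thus becomes a recurrence between
    consecutive moments of f. The constant function obeys the same recurrence with right-hand side
    0. Comparing the two shows that the kernel averages of phi strictly increase with k once those
    of phi'' are negative, although they must tend to the minimum of phi. *)

Section Smooth.
Variable R : realType.
Implicit Types f g : R -> R.

(* Explicit periodic functions forming a class closed under differentiation, which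
   makes their smoothness a one-line induction. *)
Inductive salg : (R -> R) -> Prop :=
| salg_cst c : salg (fun=> c)
| salg_sin : salg sin
| salg_cos : salg cos
| salg_add f g : salg f -> salg g -> salg (fun x => f x + g x)
| salg_mul f g : salg f -> salg g -> salg (fun x => f x * g x)
| salg_exp f : salg f -> salg (fun x => expR (f x))
| salg_inv f : salg f -> (forall x, 0 < f x) -> salg (fun x => (f x)^-1).

Lemma salg_opp f : salg f -> salg (fun x => - f x).
Proof.
move=> sf; rewrite (_ : (fun x => - f x) = (fun x => -1 * f x)).
  by apply: salg_mul => //; exact: salg_cst.
by apply/funext => x; rewrite mulN1r.
Qed.

Lemma salg_pow f k : salg f -> salg (fun x => f x ^+ k).
Proof.
move=> sf; elim: k => [|k IH]; first exact: salg_cst.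
rewrite (_ : (fun x => f x ^+ k.+1) = (fun x => f x * f x ^+ k)).
  exact: salg_mul.
by apply/funext => x; rewrite exprS.
Qed.

Lemma salg_derive f : salg f ->
  exists2 g, salg g & forall x, is_derive x (1 : R) f (g x).
Proof.
elim=> [c|||{}f g sf [f' sf' df] sg [g' sg' dg]|{}f g sf [f' sf' df] sg [g' sg' dg]
  |{}f sf [f' sf' df]|{}f sf [f' sf' df] f0].
- by exists (fun=> 0); [exact: salg_cst | move=> x; exact: is_derive_cst].
- by exists cos; [exact: salg_cos | move=> x; exact: is_derive_sin].
- exists (fun x => - sin x); first by apply: salg_opp; exact: salg_sin.
  by move=> x; exact: is_derive_cos.
- exists (fun x => f' x + g' x); first exact: salg_add.
  by move=> x; exact: is_deriveD.
- exists (fun x => f x * g' x + g x * f' x).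
    by apply: salg_add; exact: salg_mul.
  by move=> x; exact: is_deriveM.
- exists (fun x => expR (f x) * f' x).
    by apply: salg_mul => //; exact: salg_exp.
  by move=> x; apply: is_derive1_comp.
- exists (fun x => - ((f x)^-1 * (f x)^-1 * f' x)).
    by apply: salg_opp; apply: salg_mul => //; apply: salg_mul; exact: salg_inv.
  move=> x; have fx0 : f x != 0 by rewrite gt_eqF.
  have := is_deriveV fx0 (df x).
  by rewrite /GRing.scale/= mulNr -exprVn expr2.
Qed.

Lemma salg_periodic f : salg f -> periodic2pi f.
Proof.
elim=> [c|||{}f g _ pf _ pg|{}f g _ pf _ pg|{}f _ pf|{}f _ pf _] x //=;
  rewrite ?pf ?pg//.
- by rewrite (_ : 2 * pi = pi *+ 2) ?sin2pi ?sinDpi2 ?sinD2pi // mulr_natl.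
- by rewrite (_ : 2 * pi = pi *+ 2) ?cosD2pi // mulr_natl.
Qed.

Lemma derive_continuous f g : (forall x, is_derive x (1 : R) f (g x)) ->
  continuous f.
Proof.
by move=> df x; apply/differentiable_continuous/derivable1_diffP; have [] := df x.
Qed.

Lemma is_derive_derive1 f g : (forall x, is_derive x (1 : R) f (g x)) ->
  derive1 f = g.
Proof. by move=> df; apply/funext => x; rewrite derive1E; have [] := df x. Qed.

Lemma salg_continuous f : salg f -> continuous f.
Proof. by move=> /salg_derive[g _ /derive_continuous]. Qed.

Lemma smooth_primitive f g : (forall x, is_derive x (1 : R) f (g x)) ->
  smooth g -> smooth f.
Proof.
move=> df sg [|k] x; first by have [] := df x.
by rewrite /iderive iterSr (is_derive_derive1 df); exact: sg.
Qed.

Lemma smooth_derive1 f : smooth f ->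
  smooth (derive1 f) /\ forall x, is_derive x (1 : R) f (derive1 f x).
Proof.
move=> sf; split=> [k x|x]; first by have := sf k.+1 x; rewrite /iderive iterSr.
by rewrite derive1E; apply: DeriveDef => //; exact: (sf 0%N).
Qed.

Lemma smooth_continuous f : smooth f -> continuous f.
Proof. by move=> /smooth_derive1[_ /derive_continuous]. Qed.

Lemma salg_smooth f : salg f -> smooth f.
Proof.
move=> sf k; elim: k f sf => [|k IH] f /salg_derive[g sg df] x.
  by have [] := df x.
by rewrite /iderive iterSr (is_derive_derive1 df); exact: IH.
Qed.

Lemma salg_test f : salg f -> test_fun f.
Proof. by move=> sf; split; [exact: salg_smooth | exact: salg_periodic]. Qed.

Lemma periodic2pi_derive1 f : periodic2pi f -> periodic2pi (derive1 f).
Proof.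
move=> pf x; rewrite /derive1.
suff -> : (fun h => h^-1 *: (f (h + (x + 2 * pi)) - f (x + 2 * pi))) =
          (fun h => h^-1 *: (f (h + x) - f x)) by [].
by apply/funext => h; rewrite addrA !pf.
Qed.

Lemma test_derive1 f : test_fun f -> test_fun (derive1 f).
Proof.
move=> [sf pf]; split; last exact: periodic2pi_derive1.
by have [] := smooth_derive1 sf.
Qed.

End Smooth.

(** * Integrals over the circle *)

Section Integrals.
Variable R : realType.
Implicit Types f g h : R -> R.
Local Notation mu := (@lebesgue_measure R).

Definition L1 f : Prop := mu.-integrable (@S1 R) (EFin \o f).

Lemma measurable_S1 : measurable (@S1 R : set (measurableTypeR R)).
Proof. exact: measurable_itv. Qed.

Lemma L1_measurable f : L1 f -> measurable_fun (@S1 R) f.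
Proof. by move=> /integrableP[/measurable_EFinP]. Qed.

Lemma continuous_integrable f a b : continuous f ->
  mu.-integrable `[a, b] (EFin \o f).
Proof.
move=> cf; apply: continuous_compact_integrable; first exact: segment_compact.
exact: continuous_subspaceT.
Qed.

Lemma continuous_L1 f : continuous f -> L1 f.
Proof. exact: continuous_integrable. Qed.

Lemma continuous_measurable f (A : set R) : measurable A -> continuous f -> measurable_fun A f.
Proof. move=> mA cf; apply: measurable_funTS; exact: continuous_measurable_fun. Qed.

Lemma L1D f g : L1 f -> L1 g -> L1 (fun x => f x + g x).
Proof. by move=> Lf Lg; have := integrableD measurable_S1 Lf Lg; apply. Qed.

Lemma L1B f g : L1 f -> L1 g -> L1 (fun x => f x - g x).
Proof. by move=> Lf Lg; have := integrableB measurable_S1 Lf Lg; apply. Qed.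

Lemma L1Z c f : L1 f -> L1 (fun x => c * f x).
Proof. by move=> Lf; have := integrableZl measurable_S1 c Lf; apply. Qed.

Lemma L1_le f g : measurable_fun (@S1 R) f -> L1 g ->
  (forall x, S1 x -> `|f x| <= g x) -> L1 f.
Proof.
move=> mf Lg fg; apply: le_integrable Lg; first exact: measurable_S1.
  exact/measurable_EFinP.
by move=> x /fg fgx /=; rewrite lee_fin (le_trans fgx)// ler_norm.
Qed.

Lemma continuous_S1_bounded g : continuous g ->
  exists2 M, 0 < M & forall x, S1 x -> `|g x| <= M.
Proof.
move=> cg.
have cg' : {within `[- pi, pi], continuous (fun x => `|g x|)}.
  by apply: continuous_subspaceT => x; apply: cvg_norm; exact: cg.
have pp : - pi <= pi :> R by rewrite ge0_cp// ?pi_ge0.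
have [x0 _ x0M] := EVT_max pp cg'.
exists (`|g x0| + 1); first by rewrite ltr_wpDl.
move=> x Sx; rewrite (@le_trans _ _ `|g x0|) ?lerDl//.
by apply: x0M; move: Sx; rewrite /S1 /= .
Qed.

Lemma L1M f g : L1 f -> continuous g -> L1 (fun x => f x * g x).
Proof.
move=> Lf cg; have [M M0 gM] := continuous_S1_bounded cg.
apply: (@L1_le _ (fun x => M * `|f x|)).
- apply: measurable_funM; first exact: L1_measurable.
  exact: continuous_measurable measurable_S1 cg.
- by apply: L1Z; exact: (integrable_abse Lf).
- by move=> x /gM gx; rewrite normrM mulrC ler_wpM2r.
Qed.

Lemma S1intD f g : L1 f -> L1 g ->
  S1int (fun x => f x + g x) = S1int f + S1int g.
Proof. by move=> Lf Lg; rewrite /S1int RintegralD//; exact: measurable_S1. Qed.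

Lemma S1intB f g : L1 f -> L1 g ->
  S1int (fun x => f x - g x) = S1int f - S1int g.
Proof. by move=> Lf Lg; rewrite /S1int RintegralB//; exact: measurable_S1. Qed.

Lemma S1intZ c f : L1 f -> S1int (fun x => c * f x) = c * S1int f.
Proof. by move=> Lf; rewrite /S1int RintegralZl//; exact: measurable_S1. Qed.

Lemma S1int_ext f g : f =1 g -> S1int f = S1int g.
Proof. by move=> /funext ->. Qed.

Lemma S1int_le f g : L1 f -> L1 g -> (forall x, S1 x -> f x <= g x) ->
  S1int f <= S1int g.
Proof. by move=> Lf Lg fg; apply: le_Rintegral => //; exact: measurable_S1. Qed.

Lemma S1int_ae f g : measurable_fun (@S1 R) f -> measurable_fun (@S1 R) g ->
  {ae mu, forall x, S1 x -> f x = g x} -> S1int f = S1int g.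
Proof.
move=> mf mg fg; congr fine; apply: ae_eq_integral.
- exact: measurable_S1.
- exact/measurable_EFinP.
- exact/measurable_EFinP.
- move: fg; apply: filterS; first exact: (ae_filter_ringOfSetsType mu).
  by move=> x fgx /fgx /= ->.
Qed.

Lemma S1int_cst (c : R) : S1int (fun=> c) = 2 * pi * c.
Proof.
have mS : mu (@S1 R) = (2 * pi)%:E.
  rewrite /S1; have := lebesgue_measure_itv `[(- pi : R), pi] => /= ->.
  by rewrite lte_fin gt0_cp ?pi_gt0//= -EFinB; congr EFin; ring.
rewrite /S1int Rintegral_cst; last exact: measurable_S1.
by rewrite mulrC; congr (_ * _); have := congr1 fine mS.
Qed.

Lemma FTC f F a b : continuous f ->
  (forall x, is_derive x (1 : R) F (f x)) -> a <= b ->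
  Rintegral mu `[a, b] f = F b - F a.
Proof.
move=> cf dF; rewrite le_eqVlt => /predU1P[->|ab].
  by rewrite set_itv1 Rintegral_set1 subrr.
have cF : continuous F.
  by move=> x; apply/differentiable_continuous/derivable1_diffP; have [] := dF x.
rewrite /Rintegral (@continuous_FTC2 _ f F)//.
- exact: continuous_subspaceT.
- by split; [move=> x _; have [] := dF x | apply: cvg_at_right_filter; exact: cF
    | apply: cvg_at_left_filter; exact: cF].
- by move=> x _; rewrite derive1E; have [] := dF x.
Qed.

Lemma has_primitive f : continuous f ->
  exists F, forall x, is_derive x (1 : R) F (f x).
Proof.
move=> cf.
(* The value does not depend on the base point [a], as long as it lies to the left of both 0 and
   [x]. A base point moving with [x] therefore gives a primitive on the whole line. *)
pose I a x := Rintegral mu `[a, x] f - Rintegral mu `[a, 0] f.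
have II a b x : a <= b -> b <= x -> b <= 0 -> I a x = I b x.
  move=> ab bx b0; rewrite /I.
  have key y : b <= y -> Rintegral mu `[a, y] f =
      Rintegral mu `[a, b] f + Rintegral mu `[b, y] f.
    move=> y0; have H := @Rintegral_itvB R f (BLeft a) (BRight y) b.
    rewrite -(@Rintegral_itv_obnd_cbnd R b (BRight y)); last first.
      apply: integrableS (continuous_integrable b y cf) => //.
      by apply: subset_itvr; rewrite bnd_simp.
    rewrite -H ?bnd_simp//; last exact: continuous_integrable.
    by ring.
  rewrite (key x)// (key 0)//; ring.
exists (fun x => I (- `|x| - 1) x) => x.
(* One further unit to the left, so that this fixed base point stays admissible for every y within
   distance 1 of [x]. *)
pose a := - `|x| - 2.
have ax : a < x.
  by rewrite /a; have := ler_norm (- x); rewrite normrN => ?; lra.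
have [dI I'] := @continuous_FTC1_closed R f a x (x + 1)
  ltac:(by rewrite ltrDl) (continuous_integrable a (x + 1) cf) ax (cf x).
have dIa : is_derive x (1 : R) (I a) (f x).
  have -> : f x = f x - 0 by rewrite subr0.
  apply: is_deriveB.
  by rewrite -I' derive1E; apply: DeriveDef.
apply: (near_eq_is_derive _ dIa) => //.
near=> y.
have yx : `|y - x| < 1.
  rewrite distrC; near: y.
  by apply: (nbhsx_ballx x (1 : R)).
have yn : `|y| <= `|x| + `|y - x|.
  by rewrite (le_trans _ (ler_normD _ _))// addrC subrK.
apply: II; rewrite /a.
- lra.
- by have := ler_norm (- y); rewrite normrN => ?; lra.
- by have := normr_ge0 y; lra.
Unshelve. all: end_near. Qed.

End Integrals.

Local Ltac itv_sub :=
  move=> x; rewrite ?/S1 /= !in_itv/= => /andP[? ?]; apply/andP; split; lra.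

(** * Functions that are continuous on each of the two open arcs cut out by 0 and pi *)

Section Piecewise.
Variable R : realType.
Implicit Types f g h : R -> R.
Local Notation mu := (@lebesgue_measure R).

Lemma in_S1 (x : R) : S1 x = (- pi <= x <= pi) :> Prop.
Proof. by rewrite /S1/= in_itv. Qed.

Lemma measurable_pw f f1 f2 : continuous f1 -> continuous f2 ->
  (forall x, - pi < x < 0 -> f x = f1 x) -> (forall x, 0 < x < pi -> f x = f2 x) ->
  measurable_fun (@S1 R) f.
Proof.
move=> c1 c2 e1 e2.
have mitv (i : interval R) : measurable ([set` i] : set (measurableTypeR R)).
  by have := @measurable_itv R i; apply.
have m1 (a : R) : measurable ([set a] : set (measurableTypeR R)).
  by have := @measurable_set1 R a; apply.
apply: (@measurable_funS _ _ (measurableTypeR R) _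
  (([set - pi] `|` `]- pi, 0[) `|` ([set 0] `|` (`]0, pi[ `|` [set pi])))).
- by do ?[apply: measurableU].
- move=> x; rewrite in_S1 => /andP[].
  rewrite le_eqVlt => /predU1P[<- _|px]; first by left; left.
  rewrite le_eqVlt => /predU1P[->|xp]; first by right; right; right.
  have [x0|x0|->] := ltgtP x 0; last by right; left.
  + by left; right; rewrite /= in_itv/= px.
  + by right; right; left; rewrite /= in_itv/= xp x0.
- have ms (a : R) : measurable_fun ([set a] : set (measurableTypeR R)) f.
    exact: measurable_fun_set1.
  apply/measurable_funU => //; [by do ?[apply: measurableU]..|split].
    apply/measurable_funU => //; split => //.
    apply: (@eq_measurable_fun _ _ _ _ _ f1).
      by move=> x; rewrite inE/= in_itv/= => /e1.
    exact: continuous_measurable.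
  apply/measurable_funU => //; [by do ?[apply: measurableU]..|split => //].
  apply/measurable_funU => //; split => //.
  apply: (@eq_measurable_fun _ _ _ _ _ f2).
    by move=> x; rewrite inE/= in_itv/= => /e2.
  exact: continuous_measurable.
Qed.

Lemma bounded_pw f f1 f2 : continuous f1 -> continuous f2 ->
  (forall x, - pi < x < 0 -> f x = f1 x) -> (forall x, 0 < x < pi -> f x = f2 x) ->
  exists2 M, 0 < M & forall x, S1 x -> `|f x| <= M.
Proof.
move=> c1 c2 e1 e2.
have [M1 M10 B1] := continuous_S1_bounded c1.
have [M2 M20 B2] := continuous_S1_bounded c2.
exists (M1 + M2 + `|f (- pi)| + `|f 0| + `|f pi|).
  by have := normr_ge0 (f (- pi)); have := normr_ge0 (f 0); have := normr_ge0 (f pi); lra.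
have n1 := normr_ge0 (f (- pi)); have n2 := normr_ge0 (f 0); have n3 := normr_ge0 (f pi).
move=> x Sx; have B1x := B1 _ Sx; have B2x := B2 _ Sx.
move: Sx; rewrite in_S1 => /andP[].
rewrite le_eqVlt => /predU1P[<- _|px]; first by lra.
rewrite le_eqVlt => /predU1P[->|xp]; first by lra.
have [x0|x0|->] := ltgtP x 0; last by lra.
- by rewrite e1 ?px//; lra.
- by rewrite e2 ?x0//; lra.
Qed.

Lemma L1_pw f f1 f2 : continuous f1 -> continuous f2 ->
  (forall x, - pi < x < 0 -> f x = f1 x) -> (forall x, 0 < x < pi -> f x = f2 x) ->
  L1 f.
Proof.
move=> c1 c2 e1 e2; have [M M0 fM] := bounded_pw c1 c2 e1 e2.
apply: (@L1_le _ _ (fun=> M)) => //; first exact: measurable_pw c1 c2 e1 e2.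
by apply: continuous_L1 => x; exact: cvg_cst.
Qed.

Lemma Rintegral_oo_cc f (a b : R) : mu.-integrable `[a, b] (EFin \o f) ->
  Rintegral mu `]a, b[ f = Rintegral mu `[a, b] f.
Proof.
move=> If; rewrite -Rintegral_itv_obnd_cbnd ?Rintegral_itv_bndo_bndc//.
- by apply: integrableS If => //; itv_sub.
- by apply: integrableS If => //; itv_sub.
Qed.

Lemma S1int_pw f f1 f2 : continuous f1 -> continuous f2 ->
  (forall x, - pi < x < 0 -> f x = f1 x) -> (forall x, 0 < x < pi -> f x = f2 x) ->
  S1int f = Rintegral mu `[- pi, 0] f1 + Rintegral mu `[0, pi] f2.
Proof.
move=> c1 c2 e1 e2; have If := L1_pw c1 c2 e1 e2.
have p0 : 0 < pi :> R by exact: pi_gt0.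
have := @Rintegral_itvB R f (BLeft (- pi)) (BRight pi) 0 If.
rewrite !bnd_simp => /(_ ltac:(lra) ltac:(lra)) H.
have mS := @measurable_S1 R.
have I1 : mu.-integrable `[- pi, 0] (EFin \o f).
  by apply: integrableS If => //; itv_sub.
have I2 : mu.-integrable `[0, pi] (EFin \o f).
  by apply: integrableS If => //; itv_sub.
rewrite -(Rintegral_oo_cc (continuous_integrable _ _ c1)).
rewrite -(Rintegral_oo_cc (continuous_integrable _ _ c2)).
rewrite -(@eq_Rintegral _ _ _ mu _ f1 f); last first.
  by move=> x; rewrite inE/= in_itv/= => /e1.
rewrite -(@eq_Rintegral _ _ _ mu _ f2 f); last first.
  by move=> x; rewrite inE/= in_itv/= => /e2.
rewrite !Rintegral_oo_cc// -(@Rintegral_itv_obnd_cbnd R 0 (BRight pi)).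
  by rewrite -H /S1int /S1; ring.
by apply: integrableS I2 => //; itv_sub.
Qed.

Lemma lam_neg (x : R) : - pi < x < 0 -> lam x = -1.
Proof.
move=> /andP[x1 x2]; rewrite /lam ifT// -oppr_gt0 -sinN.
by apply: sin_gt0_pi; apply/andP; split; lra.
Qed.

Lemma lam_pos (x : R) : 0 < x < pi -> lam x = 1.
Proof. by move=> x0; rewrite /lam ifF// ltNge ltW// sin_gt0_pi. Qed.

Lemma S1int_derive f F : continuous f ->
  (forall x, is_derive x (1 : R) F (f x)) -> S1int f = F pi - F (- pi).
Proof.
by move=> cf dF; rewrite /S1int (FTC cf dF)// ge0_cp// pi_ge0.
Qed.

Lemma S1int_pw_derive f f1 f2 F1 F2 : continuous f1 -> continuous f2 ->
  (forall x, - pi < x < 0 -> f x = f1 x) -> (forall x, 0 < x < pi -> f x = f2 x) ->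
  (forall x, is_derive x (1 : R) F1 (f1 x)) ->
  (forall x, is_derive x (1 : R) F2 (f2 x)) ->
  S1int f = (F1 0 - F1 (- pi)) + (F2 pi - F2 0).
Proof.
move=> c1 c2 e1 e2 d1 d2; rewrite (S1int_pw c1 c2 e1 e2).
by rewrite (FTC c1 d1) ?(FTC c2 d2) ?pi_ge0// ge0_cp// pi_ge0.
Qed.

End Piecewise.

(** * The du Bois-Reymond lemma *)

Section DuBoisReymond.
Variable R : realType.
Implicit Types f g h : R -> R.
Local Notation mu := (@lebesgue_measure R).

Lemma test_primitive g : salg g -> S1int g = 0 ->
  exists2 psi, test_fun psi & derive1 psi = g.
Proof.
move=> sg g0; have cg := salg_continuous sg.
have [F dF] := has_primitive cg.
exists F; last exact: is_derive_derive1.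
split; first exact: smooth_primitive dF (salg_smooth sg).
(* The increment over one period has derivative zero, and at - pi it equals the integral of [g],
   which vanishes. *)
move=> x; pose H y := F (y + 2 * pi) - F y.
have dH y : is_derive y (1 : R) H 0.
  rewrite (_ : 0 = g (y + 2 * pi) * 1 - g y); last first.
    by rewrite (salg_periodic sg) mulr1 subrr.
  apply: is_deriveB.
  apply: (@is_derive1_comp _ F (fun y => y + 2 * pi)).
  by rewrite -[X in is_derive _ _ _ X]addr0; apply: is_deriveD.
have : H x = H (- pi) by exact: is_derive_0_is_cst.
rewrite {2}/H (_ : - pi + 2 * pi = pi); last by ring.
by rewrite -(S1int_derive cg dF) g0 => /eqP; rewrite subr_eq0 => /eqP.
Qed.

(** Only functions of mean zero are derivatives of test functions. Subtracting from [g] its mean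
    makes it one, and the correction is then moved onto [f]. *)
Lemma orthogonal_salg f : L1 f ->
  (forall psi, test_fun psi -> S1int (fun x => f x * derive1 psi x) = 0) ->
  forall g, salg g -> S1int (fun x => (f x - S1int f / (2 * pi)) * g x) = 0.
Proof.
move=> Lf f0 g sg; have cg := salg_continuous sg.
have p0 : (pi : R) != 0 by rewrite gt_eqF// pi_gt0.
pose m := S1int g / (2 * pi).
have cm (c : R) : continuous (fun _ : R => c) by move=> x; exact: cvg_cst.
have Lg := continuous_L1 cg.
have [||psi tpsi dpsi] := @test_primitive (fun x => g x + - m).
- by apply: salg_add => //; exact: salg_cst.
- rewrite (S1intB Lg (continuous_L1 (cm m))) S1int_cst /m mulrC divfK ?subrr//.
  by rewrite mulf_neq0.
have := f0 _ tpsi; rewrite dpsi.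
rewrite (@S1int_ext _ _ (fun x => f x * g x - m * f x)); last by move=> x; ring.
rewrite (S1intB (L1M Lf cg) (L1Z m Lf)) (S1intZ _ Lf) => /eqP.
rewrite subr_eq0 => /eqP fg.
rewrite (@S1int_ext _ _ (fun x => f x * g x - (S1int f / (2 * pi)) * g x)); last by move=> x; ring.
rewrite (S1intB (L1M Lf cg) (L1Z _ Lg)) (S1intZ _ Lg) fg /m.
by set k := (2 * pi)^-1; ring.
Qed.

(** A cosine centred at the midpoint of the arc from - pi to b, minus its value at the two ends: a
    trigonometric polynomial that is positive on exactly this arc of the circle. *)
Definition arc (b x : R) := cos (x + (pi - b) / 2) - cos ((pi + b) / 2).

Lemma arcE (b x : R) : arc b x = 2 * (sin ((x + pi) / 2) * sin ((b - x) / 2)).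
Proof.
pose A := (x + pi) / 2; pose B := (b - x) / 2.
rewrite /arc (_ : x + (pi - b) / 2 = A - B); last by rewrite /A /B; field.
rewrite (_ : (pi + b) / 2 = A + B); last by rewrite /A /B; field.
rewrite cosB cosD -/A -/B; ring.
Qed.

Lemma arc_gt0 (b x : R) : - pi < b < pi -> S1 x -> (0 < arc b x) = (- pi < x < b).
Proof.
move=> /andP[b1 b2]; rewrite in_S1 => /andP[x1 x2]; rewrite arcE.
rewrite pmulr_rgt0//; apply/idP/idP => [|/andP[px xb]].
  apply: contraLR; rewrite negb_and -!leNgt => /orP[xp|bx].
    by rewrite (_ : x = - pi) ?addNr ?mul0r ?sin0 ?mul0r//; apply/eqP; rewrite eq_le xp.
  rewrite mulr_ge0_le0//; first by apply: sin_ge0_pi; lra.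
  rewrite -oppr_ge0 -sinN; apply: sin_ge0_pi; lra.
by rewrite mulr_gt0// sin_gt0_pi//; lra.
Qed.

Lemma salg_arc b : salg (arc b).
Proof.
rewrite (_ : arc b = fun x => (cos x * cos ((pi - b) / 2)
    + - (sin x * sin ((pi - b) / 2))) + - cos ((pi + b) / 2)); last first.
  by apply/funext => x; rewrite /arc cosD.
apply: salg_add; last exact: salg_cst.
by apply: salg_add; last apply: salg_opp; apply: salg_mul;
  do ?[exact: salg_cst|exact: salg_cos|exact: salg_sin].
Qed.

(* As n grows these tend pointwise to the indicator of {s > 0}: the extra term n
   makes the limit vanish on {s = 0} too. *)
Definition step (n : nat) (s : R) := (1 + expR (n%:R + - (n%:R ^+ 2 * s)))^-1.

Lemma salg_step n s : salg s -> salg (fun x => step n (s x)).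
Proof.
move=> ss; apply: salg_inv; last by move=> x; rewrite addr_gt0// expR_gt0.
apply: salg_add; first exact: salg_cst.
apply: salg_exp; apply: salg_add; first exact: salg_cst.
by apply: salg_opp; apply: salg_mul => //; exact: salg_cst.
Qed.

Lemma step_itv n s : 0 <= step n s <= 1.
Proof.
have := expR_gt0 (n%:R + - (n%:R ^+ 2 * s)); rewrite /step => e0.
rewrite invr_ge0 invf_le1; last lra.
by apply/andP; split; lra.
Qed.

Lemma step_cvg s : (fun n => step n s) @ \oo --> ((0 < s)%R%:R : R).
Proof.
have near_inv n (e : R) : n%:R <= e -> (1 + expR e)^-1 <= n.+1%:R^-1.
  have e0 := expR_gt0 e; have n0 : 0 < n.+1%:R :> R by rewrite ltr0n.
  move=> ne; rewrite lef_pV2 ?posrE ?n0//.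
  have := expR_ge1Dx e; rewrite -natr1; lra.
have [s0|s0] := ltP 0 s; last first.
  apply: (@squeeze_cvgr _ _ _ _ (fun=> 0) (@harmonic R)); last 2 first.
  - exact: cvg_cst.
  - exact: cvg_harmonic.
  near=> n; have /andP[st0 st1] := step_itv n s; rewrite ?st0 ?st1/= /harmonic/=.
  apply: near_inv; rewrite lerDl oppr_ge0 mulr_ge0_le0//.
apply: (@squeeze_cvgr _ _ _ _ (fun n => 1 - @harmonic R n) (fun=> 1)); last 2 first.
- rewrite -[X in _ --> X]subr0; apply: cvgB; first exact: cvg_cst.
  exact: cvg_harmonic.
- exact: cvg_cst.
near=> n; have /andP[st0 st1] := step_itv n s; rewrite ?st0 ?st1 ?andbT /harmonic/=.
(* This makes n^2 s - n at least n. The bound for a large exponent then applies to the reflected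
   logistic function, using 1 / (1 + e^-a) = 1 - 1 / (1 + e^a). *)
have ns : 2 <= n%:R * s.
  rewrite -ler_pdivrMr//; near: n; exact: nbhs_infty_ger.
pose e := n%:R - n%:R ^+ 2 * s.
have en : n%:R <= - e.
  have := ler_wpM2l (ler0n R n) ns; rewrite /e expr2 -mulrA; lra.
have := near_inv _ _ en; rewrite expRN /step -/e.
have := expR_gt0 e => e0.
rewrite (_ : (1 + (expR e)^-1)^-1 = 1 - (1 + expR e)^-1); last first.
  field; apply/andP; split; rewrite gt_eqF//; lra.
by rewrite !lerBlDr addrC.
Unshelve. all: end_near. Qed.

(** The admissible functions [step n (arc b x)] lie between 0 and 1 and tend pointwise to the
    indicator of the open arc from - pi to b. Dominated convergence, with majorant |h|, carries the
    orthogonality over to the limit. *)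
Lemma orthogonal_itv h b : L1 h ->
  (forall g, salg g -> S1int (fun x => h x * g x) = 0) ->
  - pi < b < pi -> Rintegral mu `[- pi, b] h = 0.
Proof.
move=> Lh h0 bpi.
have mS := @measurable_S1 R.
have Ln n : L1 (fun x => h x * step n (arc b x)).
  by apply: L1M => //; apply: salg_continuous; apply: salg_step; exact: salg_arc.
have mind : measurable_fun (@S1 R) (fun x => ((0 < arc b x)%R%:R : R)).
  apply: measurableT_comp => //.
  apply: measurable_fun_ltr => //.
  by have := continuous_measurable mS (salg_continuous (salg_arc b)); apply.
have [] := @dominated_convergence _ _ _ mu (@S1 R) mS
  (fun n x => (h x * step n (arc b x))%:E)
  (fun x => (h x * ((0 < arc b x)%R%:R : R))%:E) (fun x => `|h x|%:E).
- by move=> n; apply/measurable_EFinP; exact: L1_measurable.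
- by apply/measurable_EFinP; apply: measurable_funM => //; exact: L1_measurable.
- apply: aeW => x Sx; apply/cvg_EFin; first by near=> n.
  by apply: cvgM; [exact: cvg_cst|exact: step_cvg].
- exact: (integrable_abse Lh).
- apply: aeW => x n Sx /=; rewrite lee_fin normrM ler_piMr//.
  by have /andP[? ?] := step_itv n (arc b x); rewrite ger0_norm.
move=> Lind _ H.
have : S1int (fun x => h x * ((0 < arc b x)%R%:R : R)) = 0.
  rewrite /S1int /Rintegral;
  suff -> : (\int[mu]_(x in @S1 R) (h x * ((0 < arc b x)%R%:R : R))%:E = 0)%E by [].
  have E n : (\int[mu]_(x in @S1 R) (h x * step n (arc b x))%:E = 0)%E.
    rewrite -[LHS]fineK; first by congr EFin; apply: h0; exact/salg_step/salg_arc.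
    by have := integrable_fin_num mS (Ln n); apply.
  have {}H : (fun=> 0%E : \bar R) @ \oo -->
      (\int[mu]_(x in @S1 R) (h x * ((0 < arc b x)%R%:R : R))%:E)%E.
    by rewrite (_ : (fun=> _) = (fun n => \int[mu]_(x in @S1 R) (h x * step n (arc b x))%:E)%E)//;
      apply/funext => n; rewrite E.
  by apply: (cvg_unique _ H); [exact: ereal_hausdorff|exact: cvg_cst].
have p0 : 0 < pi :> R by exact: pi_gt0.
rewrite -(@Rintegral_oo_cc _ h).
  move=> <-; rewrite /S1int.
  rewrite (_ : `]- pi, b[%classic = @S1 R `&` `]- pi, b[%classic); last first.
    apply/esym/setIidPr => x /=; rewrite in_S1 in_itv/= => /andP[x1 x2].
    by move: bpi => /andP[b1 b2]; lra.
  rewrite Rintegral_mkcondr; apply: eq_Rintegral => x; rewrite inE => Sx.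
  rewrite arc_gt0// /patch mem_setE in_itv/=; case: ifP => _; rewrite ?mulr1 ?mulr0//.
apply: integrableS Lh => //; case/andP: bpi => ? ?; itv_sub.
Unshelve. all: end_near. Qed.

Lemma ae_neq (a : R) : {ae mu, forall x, x != a}.
Proof.
exists [set a]; split; [exact: measurable_set1|exact: lebesgue_measure_set1|].
by move=> x /= /negP; rewrite negbK => /eqP.
Qed.

(** By Lebesgue differentiation [h] is almost everywhere the derivative of its integral from - pi,
    which is identically zero. The two endpoints are discarded as null sets, because the derivative
    is read off a two-sided neighbourhood. *)
Lemma itv_integral0_ae h : L1 h ->
  (forall b, - pi < b < pi -> Rintegral mu `[- pi, b] h = 0) ->
  {ae mu, forall x, S1 x -> h x = 0}.
Proof.
move=> Lh h0; have p0 : 0 < pi :> R by exact: pi_gt0.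
have loc := integrable_locally (@measurable_S1 R) Lh.
have Ir : mu.-integrable setT (EFin \o (h \_ (@S1 R))).
  rewrite -restrict_EFin.
  have := (integrable_restrict mu (@measurable_S1 R) measurableT (EFin \o h)).1.
  by rewrite setTI; apply.
have Iy y : mu.-integrable [set` Interval (BLeft (- pi)) (BRight y)] (EFin \o h \_ (@S1 R)).
  by apply: integrableS Ir => //; exact: measurable_itv.
have /= := @FTC1 R (h \_ (@S1 R)) (BLeft (- pi)) Iy loc.
have F := ae_filter_ringOfSetsType mu.
move=> H; have H1 := ae_neq pi; have H2 := ae_neq (- pi).
move: H1 H2 H; apply: filterS3 => x xp xNp Hx.
rewrite in_S1 => /andP[x1 x2].
have {}x1 : - pi < x by rewrite lt_neqAle eq_sym xNp.
have {}x2 : x < pi by rewrite lt_neqAle xp.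
move: Hx; rewrite lte_fin => /(_ x1)[_].
rewrite patchE mem_set ?in_S1 ?(ltW x1) ?(ltW x2)// => <-.
rewrite derive1E.
have d0 := is_derive_cst (0 : R) x (1 : R).
apply: derive_val; apply: near_eq_is_derive d0.
near=> y.
have yp : y < pi by near: y; exact: lt_nbhsl.
have ypn : - pi < y by near: y; exact: lt_nbhsr.
rewrite /= -[LHS](h0 y) ?ypn//; apply: eq_Rintegral => z.
rewrite inE/= in_itv/= => /andP[z1 z2]; rewrite patchE mem_set// in_S1 z1/=; lra.
Unshelve. all: end_near. Qed.

Lemma du_bois_reymond f : L1 f ->
  (forall psi, test_fun psi -> S1int (fun x => f x * derive1 psi x) = 0) ->
  exists s, {ae mu, forall x, S1 x -> f x = s}.
Proof.
move=> Lf f0; exists (S1int f / (2 * pi)).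
have Lh : L1 (fun x => f x - S1int f / (2 * pi)).
  by apply: L1B => //; apply: continuous_L1 => x; exact: cvg_cst.
have := itv_integral0_ae Lh (fun b => orthogonal_itv Lh (orthogonal_salg Lf f0)).
apply: filterS; first exact: (ae_filter_ringOfSetsType mu).
by move=> x fx Sx; apply/eqP; rewrite -subr_eq0 fx.
Qed.

End DuBoisReymond.

(** * Concentrating kernels and the maximum principle *)

Section Kernel.
Variable R : realType.
Implicit Types f g h : R -> R.
Local Notation mu := (@lebesgue_measure R).

(** This is cos^2((x - x0) / 2). Its maximum 1 is attained at a single point of the circle, so its
    normalized powers concentrate there. *)
Definition bump (x0 x : R) := (1 + cos (x - x0)) / 2.

Lemma bump_itv x0 x : 0 <= bump x0 x <= 1.
Proof.
have := cos_geN1 (x - x0); have := cos_le1 (x - x0); rewrite /bump => *.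
apply/andP; split; lra.
Qed.

Lemma salg_bump x0 : salg (bump x0).
Proof.
rewrite (_ : bump x0 = fun x =>
    (1 + (cos x * cos x0 + sin x * sin x0)) * 2^-1); last first.
  by apply/funext => x; rewrite /bump cosB.
apply: salg_mul; last exact: salg_cst.
apply: salg_add; first exact: salg_cst.
apply: salg_add; apply: salg_mul;
  do ?[exact: salg_cst|exact: salg_cos|exact: salg_sin].
Qed.

Lemma is_derive_pow f n x df : is_derive x (1 : R) f df ->
  is_derive x (1 : R) (fun y => f y ^+ n) (n%:R * f x ^+ n.-1 * df).
Proof.
move=> d; elim: n => [|n IH].
  by rewrite !mul0r; exact: is_derive_cst.
rewrite (_ : (fun y => f y ^+ n.+1) = (fun y => f y * f y ^+ n)); last first.
  by apply/funext => y; rewrite exprS.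
rewrite (_ : _ * df = f x * (n%:R * f x ^+ n.-1 * df) + f x ^+ n * df).
  exact: is_deriveM.
by case: n {IH} => [|n] /=; rewrite ?expr0 -?natr1 ?exprS; ring.
Qed.

Lemma is_derive_bump x0 x : is_derive x (1 : R) (bump x0) (- sin (x - x0) / 2).
Proof.
have dsh : is_derive x (1 : R) (fun y => y - x0) 1.
  by rewrite -[X in is_derive _ _ _ X]subr0; apply: is_deriveB.
have dc : is_derive x (1 : R) (fun y => cos (y - x0)) (- sin (x - x0) * 1).
  exact: (@is_derive1_comp _ cos (fun y => y - x0)).
rewrite (_ : bump x0 = fun y => 2^-1 * (1 + cos (y - x0))); last first.
  by apply/funext => y; rewrite /bump mulrC.
rewrite (_ : - sin (x - x0) / 2 = 2^-1 * (0 + - sin (x - x0) * 1)); last by ring.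
by apply: is_deriveZ; apply: is_deriveD.
Qed.

Lemma derive1_bump_pow x0 k : derive1 (fun x => bump x0 x ^+ k.+1) =
  (fun x => k.+1%:R * bump x0 x ^+ k * (- sin (x - x0) / 2)).
Proof.
apply: is_derive_derive1 => x.
exact: is_derive_pow (is_derive_bump x0 x).
Qed.

(* With [c = bump x0]: [c'^2 = c (1 - c)] and [c'' = 1/2 - c]. *)
Lemma derive2_bump_pow x0 k x :
  is_derive x (1 : R) (derive1 (fun x => bump x0 x ^+ k.+1))
   (k.+1%:R * (k%:R + 2^-1) * bump x0 x ^+ k - k.+1%:R ^+ 2 * bump x0 x ^+ k.+1).
Proof.
rewrite derive1_bump_pow.
have dsh : is_derive x (1 : R) (fun y => y - x0) 1.
  by rewrite -[X in is_derive _ _ _ X]subr0; apply: is_deriveB.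
have ds : is_derive x (1 : R) (fun y => sin (y - x0)) (cos (x - x0) * 1).
  exact: (@is_derive1_comp _ sin (fun y => y - x0)).
have dp := is_derive_pow k (is_derive_bump x0 x).
rewrite (_ : (fun x => _) = (fun y => (- k.+1%:R / 2) *
  (bump x0 y ^+ k * sin (y - x0)))); last first.
  by apply/funext => y; ring.
apply: (is_derive_eq (is_deriveZ (- k.+1%:R / 2) (is_deriveM dp ds))).
rewrite /GRing.scale/=.
have s2 : sin (x - x0) ^+ 2 = 4 * (bump x0 x * (1 - bump x0 x)).
  by rewrite sin2cos2 /bump; field.
have c2 : cos (x - x0) = 2 * bump x0 x - 1 by rewrite /bump; field.
rewrite c2; set b := bump x0 x.
have -> : sin (x - x0) * (k%:R * b ^+ k.-1 * (- sin (x - x0) / 2)) =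
   - 2 * (k%:R * (b ^+ k.-1 * b) * (1 - b)).
  transitivity (- (k%:R * b ^+ k.-1 / 2) * sin (x - x0) ^+ 2); first by ring.
  by rewrite s2 -/b; field.
have -> : k%:R * (b ^+ k.-1 * b) = k%:R * b ^+ k.
  by case: k {dp} => [|k]; rewrite ?mul0r//= exprSr.
by rewrite (exprS b k) -natr1; field.
Qed.

Lemma salg_bump_pow x0 k : salg (fun x => bump x0 x ^+ k).
Proof. exact/salg_pow/salg_bump. Qed.

Lemma continuous_bump_pow x0 k : continuous (fun x => bump x0 x ^+ k).
Proof. exact/salg_continuous/salg_bump_pow. Qed.

(** The hypothesis says f'' = g weakly. Testing it against the power k+1 of the kernel gives a
    relation between two consecutive moments of [f]. *)
Lemma S1int_derive2 f g : L1 f -> (forall psi, test_fun psi ->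
    S1int (fun x => f x * derive1 (derive1 psi) x) = S1int (fun x => g x * psi x)) ->
  forall x0 k, k.+1%:R * (k%:R + 2^-1) * S1int (fun x => f x * bump x0 x ^+ k)
    - k.+1%:R ^+ 2 * S1int (fun x => f x * bump x0 x ^+ k.+1)
   = S1int (fun x => g x * bump x0 x ^+ k.+1).
Proof.
move=> Lf fg x0 k; rewrite -(fg _ (salg_test (salg_bump_pow x0 k.+1))).
rewrite (is_derive_derive1 (derive2_bump_pow x0 k)).
have L j : L1 (fun x => f x * bump x0 x ^+ j).
  by apply: L1M => //; exact: continuous_bump_pow.
rewrite -!S1intZ// -S1intB; [|exact: L1Z..].
by apply: S1int_ext => x; ring.
Qed.

Lemma S1int_test_derive (psi : R -> R) : test_fun psi -> S1int (derive1 psi) = 0.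
Proof.
move=> [spsi ppsi]; have [s1 d1] := smooth_derive1 spsi.
rewrite (S1int_derive (smooth_continuous s1) d1).
by rewrite -(ppsi (- pi)) (_ : - pi + 2 * pi = pi) ?subrr//; ring.
Qed.

(** The moment relation for f = 1 and g = 0, divided by k+1; it is Wallis's recurrence for the
    integrals of even powers of cosine. *)
Lemma bump_int_rec x0 k : (k%:R + 2^-1) * S1int (fun x => bump x0 x ^+ k)
  = k.+1%:R * S1int (fun x => bump x0 x ^+ k.+1).
Proof.
have c1 : continuous (fun _ : R => 1 : R) by move=> x; exact: cvg_cst.
have := @S1int_derive2 (fun=> 1) (fun=> 0) (continuous_L1 c1) _ x0 k.
have e j : S1int (fun x => 1 * bump x0 x ^+ j) = S1int (fun x => bump x0 x ^+ j).
  by apply: S1int_ext => x; rewrite mul1r.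
have z (h : R -> R) : S1int (fun x => 0 * h x) = 0.
  by rewrite (@S1int_ext _ _ (fun=> 0)) ?S1int_cst ?mulr0// => x; rewrite mul0r.
rewrite !e z => H; have k0 : k.+1%:R != 0 :> R by rewrite pnatr_eq0.
apply: (mulfI k0); apply/eqP; rewrite -subr_eq0 mulrA mulrA -expr2; apply/eqP/H.
move=> psi tpsi; rewrite z -(S1int_test_derive (test_derive1 tpsi)).
by apply: S1int_ext => x; rewrite mul1r.
Qed.

(** The right-hand side is nondecreasing in k, since (k+2)(k+1/2) >= (k+1)^2 in Wallis's recurrence.
    A polynomial lower bound on the mass is enough, as it only competes with geometric decay. *)
Lemma bump_int_ge x0 k : 2 * pi <= k.+1%:R * S1int (fun x => bump x0 x ^+ k).
Proof.
elim: k => [|k IH].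
  by rewrite mul1r (@S1int_ext _ _ (fun=> 1)) ?S1int_cst ?mulr1.
apply: (le_trans IH); have rec := bump_int_rec x0 k.
set a := S1int _ in IH rec *; set b := S1int _ in rec *.
have k0 : 0 < k.+1%:R :> R by rewrite ltr0n.
have p0 := pi_gt0 R.
have a0 : 0 < a by rewrite -(pmulr_rgt0 _ k0); lra.
rewrite -(ler_pM2l k0) [leRHS]mulrCA -rec -(natr1 k.+1) -(natr1 k) mulrA.
rewrite [leRHS]mulrA ler_wpM2r ?(ltW a0)//.
have := ler0n R k; move: (k%:R : R) => t; nra.
Qed.

Lemma bump_int_gt0 x0 k : 0 < S1int (fun x => bump x0 x ^+ k).
Proof.
have k0 : 0 < k.+1%:R :> R by rewrite ltr0n.
rewrite -(pmulr_rgt0 _ k0); apply: lt_le_trans (bump_int_ge x0 k).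
by rewrite mulr_gt0// pi_gt0.
Qed.

(** With s the square root of rho, (k+1) s^k is at most 1 + s + ... + s^k, hence at most 1 / (1 -
    s). The other factor s^k of rho^k then tends to 0. *)
Lemma geometric_small (rho e : R) : 0 <= rho < 1 -> 0 < e ->
  exists K, forall k, (K <= k)%N -> k.+1%:R * rho ^+ k <= e.
Proof.
move=> /andP[r0 r1] e0; pose s := Num.sqrt rho.
have s0 : 0 <= s by exact: sqrtr_ge0.
have s1 : s < 1 by rewrite -sqrtr1 ltr_sqrt.
have ks k : k.+1%:R * s ^+ k * (1 - s) <= 1 - s ^+ k.+1.
  elim: k => [|k IH]; first by rewrite expr0 expr1 !mul1r.
  have sk : 0 <= s ^+ k.+1 by exact: exprn_ge0.
  have sk1 : s ^+ k.+1 <= 1 by rewrite exprn_ile1// ltW.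
  have -> : k.+2%:R * s ^+ k.+1 * (1 - s) =
    s * (k.+1%:R * s ^+ k * (1 - s)) + s ^+ k.+1 * (1 - s).
    by rewrite -(natr1 k.+1) exprS; ring.
  have := ler_wpM2l s0 IH; rewrite (exprS s k.+1).
  move: (s * _) => A; move: (s ^+ k.+1) sk sk1 => t *; nra.
have : \forall k \near \oo, `|s ^+ k| < e * (1 - s).
  apply: cvgr0_norm_lt; last by rewrite mulr_gt0// subr_gt0.
  by apply: cvg_expr; rewrite ger0_norm.
move=> [K _ HK]; exists K => k /HK; rewrite /= ger0_norm ?exprn_ge0// => sk.
have s10 : 0 < 1 - s by rewrite subr_gt0.
rewrite -(ler_pM2r s10).
rewrite -(sqr_sqrtr r0) -/s -exprM mulnC muln2 -addnn exprD.
rewrite (_ : _ * _ * (1 - s) = (k.+1%:R * s ^+ k * (1 - s)) * s ^+ k); last by ring.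
apply: le_trans (ltW sk); rewrite ler_piMl ?exprn_ge0//.
by apply: le_trans (ks k) _; rewrite gerBl exprn_ge0.
Qed.

(** Where [h] is positive the kernel is at most (1 - delta)^k. The left integral is thus at most (1
    - delta)^k times the L^1 norm of [h], while the mass of the kernel is at least 2 pi / (k+1). *)
Lemma bump_concentrates h x0 (delta e : R) : L1 h -> 0 < delta <= 1 -> 0 < e ->
  (forall x, S1 x -> 1 - delta < bump x0 x -> h x <= 0) ->
  exists K, forall k, (K <= k)%N ->
    S1int (fun x => h x * bump x0 x ^+ k) <= e * S1int (fun x => bump x0 x ^+ k).
Proof.
move=> Lh /andP[d0 d1] e0 h0.
have Lah : L1 (fun x => `|h x|) by exact: (integrable_abse Lh).
pose H := S1int (fun x => `|h x|).
have H0 : 0 <= H by apply: Rintegral_ge0.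
have p0 := pi_gt0 R.
(* The added 1 keeps the quotient meaningful when [H] is 0. *)
have [||K HK] := @geometric_small (1 - delta) (e * (2 * pi) / (H + 1)).
- by apply/andP; split; lra.
- by rewrite divr_gt0// ?mulr_gt0//; lra.
exists K => k /HK Kk.
apply: (@le_trans _ _ ((1 - delta) ^+ k * H)).
  rewrite -S1intZ//; apply: S1int_le; [|exact: L1Z|].
    by apply: L1M => //; exact: continuous_bump_pow.
  move=> x Sx; have /andP[b0 b1] := bump_itv x0 x.
  have [xd|xd] := ltP (1 - delta) (bump x0 x).
    apply: (@le_trans _ _ 0); first by rewrite mulr_le0_ge0// ?h0// exprn_ge0.
    by rewrite mulr_ge0// exprn_ge0//; lra.
  apply: (@le_trans _ _ (`|h x| * bump x0 x ^+ k)).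
    by rewrite ler_wpM2r ?exprn_ge0// ler_norm.
  by rewrite mulrC ler_wpM2r// lerXn2r// nnegrE; lra.
have k0 : 0 < k.+1%:R :> R by rewrite ltr0n.
rewrite -(ler_pM2l k0) [leRHS]mulrCA.
apply: (@le_trans _ _ (e * (2 * pi))); last first.
  by rewrite ler_wpM2l ?(ltW e0)// bump_int_ge.
have H1 : 0 < H + 1 by lra.
rewrite ler_pdivlMr// in Kk.
apply: (le_trans _ Kk); rewrite mulrA ler_wpM2l//; last lra.
by rewrite mulr_ge0// ?ler0n// exprn_ge0//; lra.
Qed.

(** The half difference z of the two points lies in [- pi, pi] and has sine 0, so it is 0 or plus or
    minus pi. In the latter cases the points are the two endpoints, which periodicity identifies. *)
Lemma periodic_bump1 g x0 x : periodic2pi g -> S1 x0 -> S1 x -> bump x0 x = 1 ->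
  g x = g x0.
Proof.
move=> pg; rewrite !in_S1 => /andP[a1 a2] /andP[b1 b2] bx.
pose z := (x - x0) / 2.
have cz : cos z ^+ 2 = 1.
  have : cos (z *+ 2) = 1.
    rewrite (_ : z *+ 2 = x - x0); last by rewrite /z -mulr_natr; field.
    by move: bx; rewrite /bump => bx; lra.
  by rewrite cos_mulr2n -mulr_natr => ?; lra.
have sz : sin z = 0.
  by apply/eqP; rewrite -sqrf_eq0 sin2cos2 cz subrr.
have xE : x = x0 + 2 * z by rewrite /z; field.
have [z0|z0|z0] := ltgtP z 0.
- have [zp|zp] := ltP (- pi) z.
    suff : 0 < sin (- z) by rewrite sinN sz oppr0 ltxx.
    by apply: sin_gt0_pi; apply/andP; split; lra.
  by rewrite -[LHS]pg; congr g; rewrite xE (_ : z = - pi) ?xE; [ring|rewrite /z in zp *; lra].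
- have [zp|zp] := ltP z pi.
    suff : 0 < sin z by rewrite sz ltxx.
    by apply: sin_gt0_pi; apply/andP; split; lra.
  by rewrite -[RHS]pg; congr g; rewrite xE (_ : z = pi) ?xE; [ring|rewrite /z in zp *; lra].
- by rewrite xE z0 mulr0 addr0.
Qed.

(** The set where g >= r is compact and the kernel is below 1 on it, since the value 1 would force g
    = g x0 there. [delta] is the gap between 1 and the maximum of the kernel on this set, or 1 if
    the set is empty. *)
Lemma near_bump1 g x0 r : continuous g -> periodic2pi g -> S1 x0 -> g x0 < r ->
  exists2 delta, 0 < delta <= 1 &
    forall x, S1 x -> 1 - delta < bump x0 x -> g x < r.
Proof.
move=> cg pg S0 g0.
pose K := @S1 R `&` [set x | r <= g x].
have cK : compact K.
  apply: (@subclosed_compact _ _ (@S1 R)); [|exact: segment_compact|by move=> x []].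
  apply: closedI; first exact: itv_closed.
  by apply: (@preimage_closed _ _ g [set y | r <= y]) => //; exact: closed_ge.
have [K0|/set0P/negP] := pselect (K !=set0); last first.
  rewrite negbK => /eqP K0; exists 1; first by rewrite ltr01 lexx.
  move=> x Sx _; rewrite ltNge; apply/negP => rx.
  by have : K x by []; rewrite K0.
have cb : {within K, continuous (bump x0)}.
  exact/continuous_subspaceT/salg_continuous/salg_bump.
have [x1] := compact_EVT_max K0 cK cb.
rewrite inE => -[S1x1 /= rx1] max1.
have /andP[b0 b1] := bump_itv x0 x1.
exists (1 - bump x0 x1).
  rewrite subr_gt0 gerBl b0 andbT lt_neqAle b1 andbT.
  apply/eqP => bx; have := periodic_bump1 pg S0 S1x1 bx => ge.
  by move: rx1; rewrite ge leNgt g0.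
move=> x Sx; rewrite subKr => bx; rewrite ltNge; apply/negP => rx.
by have := max1 x; rewrite inE leNgt bx => /(_ (conj Sx rx)).
Qed.

(** From K on the ratio J k / I k strictly increases. Being non-negative at K, it is positive at K+1
    and never falls below that value again, so it cannot tend to 0. *)
Lemma superharmonic_ratio (I J : nat -> R) (K : nat) :
  (forall k, 0 < I k) -> (forall k, 0 <= J k) ->
  (forall k, (k%:R + 2^-1) * I k = k.+1%:R * I k.+1) ->
  (forall k, (K <= k)%N -> (k%:R + 2^-1) * J k < k.+1%:R * J k.+1) ->
  ~ (forall e, 0 < e -> exists K', forall k, (K' <= k)%N -> J k <= e * I k).
Proof.
move=> I0 J0 recI recJ small.
have k0 k : 0 < k.+1%:R :> R by rewrite ltr0n.
have JK : 0 < J K.+1.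
  rewrite -(pmulr_rgt0 _ (k0 K)); apply: le_lt_trans (recJ K (leqnn K)).
  by rewrite mulr_ge0// addr_ge0// ?ler0n.
pose E := J K.+1 / I K.+1.
have E0 : 0 < E by rewrite divr_gt0.
have HE j : E * I (K.+1 + j)%N <= J (K.+1 + j)%N.
  elim: j => [|j IH]; first by rewrite addn0 /E divfK ?gt_eqF.
  rewrite addnS; set k := (K.+1 + j)%N in IH *.
  rewrite -(ler_pM2l (k0 k)) [leLHS]mulrCA -recI.
  apply: le_trans (ltW (recJ k _)); last by rewrite /k addSn -addnS leq_addr.
  by rewrite mulrCA ler_wpM2l// addr_ge0// ?ler0n.
have [|K' HK'] := small (E / 2); first by rewrite divr_gt0.
have := HK' (K.+1 + K')%N (leq_addl _ _); have := HE K'.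
have := I0 (K.+1 + K')%N => i0 h1 h2.
have := le_trans h1 h2; rewrite ler_pM2r//; lra.
Qed.

(* At a minimum [x0] of [phi], the averages of [phi - phi x0] against the
   normalized kernels [bump x0 ^+ k] tend to 0, but they increase with [k] as
   soon as the second derivative is negative near [x0]. *)
Lemma no_strictly_superharmonic_minimum f g x0 r (e : R) :
  continuous f -> periodic2pi f -> L1 g ->
  (forall psi, test_fun psi ->
    S1int (fun x => f x * derive1 (derive1 psi) x) = S1int (fun x => g x * psi x)) ->
  S1 x0 -> (forall x, S1 x -> f x0 <= f x) -> f x0 < r -> 0 < e ->
  ~ (forall x, S1 x -> f x < r -> g x <= - e).
Proof.
move=> cf pf Lg fg S0 min0 fr e0 gneg.
have ccst (c : R) : continuous (fun _ : R => c) by move=> x; exact: cvg_cst.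
have Lcst (c : R) : L1 (fun _ : R => c) by exact: continuous_L1.
have Lf := continuous_L1 cf.
have Lb k : L1 (fun x => bump x0 x ^+ k).
  exact/continuous_L1/continuous_bump_pow.
have LMb h k : L1 h -> L1 (fun x => h x * bump x0 x ^+ k).
  by move=> Lh; apply: L1M => //; exact: continuous_bump_pow.
have shift h c k : L1 h -> S1int (fun x => (h x + c) * bump x0 x ^+ k) =
    S1int (fun x => h x * bump x0 x ^+ k) + c * S1int (fun x => bump x0 x ^+ k).
  move=> Lh; rewrite -S1intZ// -S1intD; [|exact: LMb|exact: L1Z].
  by apply: S1int_ext => x; rewrite mulrDl.
pose I k := S1int (fun x => bump x0 x ^+ k).
pose J k := S1int (fun x => (f x - f x0) * bump x0 x ^+ k).
have [delta d01 near1] := near_bump1 cf pf S0 fr.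
(* Since g + e <= 0 near [x0], the kernel averages of [g] are eventually at most - e + e / 2 = - e /
   2. *)
have [|||K HK] := @bump_concentrates (fun x => g x + e) x0 delta (e / 2) _ d01.
- exact: L1D.
- by rewrite divr_gt0.
- by move=> x Sx bx; have := gneg x Sx (near1 x Sx bx); lra.
apply: (@superharmonic_ratio I J K).
- by move=> k; exact: bump_int_gt0.
- move=> k; apply: Rintegral_ge0 => x Sx; rewrite mulr_ge0//.
    by rewrite subr_ge0 min0.
  by rewrite exprn_ge0//; have /andP[] := bump_itv x0 x.
- exact: bump_int_rec.
(* The moment relation for [f] has a negative right-hand side here. Replacing [f] by f - f x0
   changes nothing, because by [bump_int_rec] the constant contributes 0. *)
- move=> k Kk; have := HK k.+1 (leqW Kk).
  rewrite shift// -/(I _) => Hg.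
  have := @S1int_derive2 f g Lf fg x0 k.
  rewrite /J !shift// -!/(I _).
  have := bump_int_rec x0 k; rewrite -!/(I _) => rec.
  have Ik := bump_int_gt0 x0 k.+1.
  have k0 : 0 < k.+1%:R :> R by rewrite ltr0n.
  rewrite -(ltr_pM2l k0) !mulrDr.
  move: Hg rec Ik; rewrite -/(I _).
  set A := S1int _; set B := S1int _; set C := S1int _ => Hg rec Ik fgk.
  have -> : k.+1%:R * ((k%:R + 2^-1) * (- f x0 * I k)) =
     - (f x0 * k.+1%:R * ((k%:R + 2^-1) * I k)) by ring.
  rewrite rec.
  have eI : 0 < e * I k.+1 by rewrite mulr_gt0.
  move: fgk; rewrite expr2; lra.
move=> e' e'0.
(* Continuity keeps f - f x0 below e' / 2 near [x0]; concentration costs the other half of e'. *)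
have [|delta' d'01 near1'] := @near_bump1 f x0 (f x0 + e' / 2) cf pf S0.
  by rewrite ltrDl divr_gt0.
have [|||K' HK'] := @bump_concentrates (fun x => f x + (- f x0 - e' / 2)) x0 delta' (e' / 2) _ d'01.
- exact: L1D.
- by rewrite divr_gt0.
- by move=> x Sx bx; have := near1' x Sx bx; lra.
exists K' => k /HK'; rewrite /J !shift// -/(I _); lra.
Qed.

End Kernel.

(** * The system *)

Section System.
Variable R : realType.
Implicit Types f g h : R -> R.
Local Notation mu := (@lebesgue_measure R).

Lemma measurable_norm_powR p f : measurable_fun (@S1 R) f ->
  measurable_fun (@S1 R) (fun x => `|f x| `^ p).
Proof.
move=> mf; have mn : measurable_fun (@S1 R) (fun x => `|f x|) by exact: measurableT_comp.
by have := measurableT_comp (measurable_powR p) mn; apply.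
Qed.

Lemma Lp_L1 p f : 1 < p -> Lp p f -> L1 f.
Proof.
move=> p1 [mf fp].
have Lfp : L1 (fun x => `|f x| `^ p).
  apply/integrableP; split.
    by apply/measurable_EFinP; have := measurable_norm_powR p mf; apply.
  apply: le_lt_trans fp; rewrite le_eqVlt; apply/orP; left; apply/eqP.
  by apply: eq_integral => x _ /=; rewrite ger0_norm// powR_ge0.
have c1 : L1 (fun _ : R => 1 : R) by apply: continuous_L1 => x; exact: cvg_cst.
apply: (L1_le mf (L1D c1 Lfp)) => x Sx.
have [f1|f1] := leP `|f x| 1; first by rewrite (le_trans f1)// lerDl powR_ge0.
rewrite -[leLHS]add0r lerD//.
by rewrite -[leLHS]powRr1// ler_powR// ltW.
Qed.

Lemma Lp_bounded p f M : 0 <= p -> measurable_fun (@S1 R) f ->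
  (forall x, S1 x -> `|f x| <= M) -> Lp p f.
Proof.
move=> p0 mf fM; split=> //.
have c1 : L1 (fun _ : R => M `^ p : R) by apply: continuous_L1 => x; exact: cvg_cst.
have : L1 (fun x => `|f x| `^ p).
  apply: (L1_le _ c1).
    by have := measurable_norm_powR p mf; apply.
  move=> x /fM fx; rewrite ger0_norm ?powR_ge0// ge0_ler_powR// nnegrE//.
  by apply: le_trans fx.
move=> /integrableP[_]; apply: le_lt_trans; rewrite le_eqVlt; apply/orP; left; apply/eqP.
by apply: eq_integral => x _ /=; rewrite (ger0_norm (powR_ge0 _ _)).
Qed.

Lemma continuous_powR f a : continuous f -> (forall x, 0 < f x) ->
  continuous (fun x => f x `^ a).
Proof.
move=> cf f0; rewrite (_ : (fun x => _) = (fun x => expR (a * ln (f x)))); last first.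
  by apply/funext => x; rewrite /powR gt_eqF.
move=> x; apply: (@continuous_comp _ _ _ (fun x => a * ln (f x)) expR); last exact: continuous_expR.
apply: cvgM; first exact: cvg_cst.
by apply: (@continuous_comp _ _ _ f (@ln R)); [exact: cf|exact: continuous_ln].
Qed.

(** The distributional identity lambda' = 2 (delta_0 - delta_pi) in tested form. *)
Lemma S1int_lam_derive psi : test_fun psi ->
  S1int (fun x => lam x * derive1 psi x) = 2 * (psi pi - psi 0) :> R.
Proof.
move=> [sp pp]; have [s1 d1] := smooth_derive1 sp.
have c1 := smooth_continuous s1.
rewrite (@S1int_pw_derive _ _ (fun x => - derive1 psi x) (derive1 psi) (fun x => - psi x) psi) //.
- have -> : psi pi = psi (- pi) by rewrite -(pp (- pi)); congr psi; ring.
  by ring.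
- by move=> x; apply: cvgN; exact: c1.
- by move=> x /lam_neg ->; rewrite mulN1r.
- by move=> x /lam_pos ->; rewrite mul1r.
Qed.

Lemma L1_lam : L1 (@lam R).
Proof.
apply: (@L1_pw _ _ (fun=> -1) (fun=> 1)).
- by move=> x; exact: cvg_cst.
- by move=> x; exact: cvg_cst.
- exact: lam_neg.
- exact: lam_pos.
Qed.

Lemma test_cst1 : test_fun (fun _ : R => 1 : R).
Proof. exact/salg_test/salg_cst. Qed.

Lemma derive1_cst1 : derive1 (fun _ : R => 1 : R) = fun=> 0.
Proof. by apply: is_derive_derive1 => x; exact: is_derive_cst. Qed.

Lemma S1int_0 : S1int (fun _ : R => 0) = 0 :> R.
Proof. by rewrite S1int_cst mulr0. Qed.

Lemma jump_equation (u : R -> R) (m0 m1 : R) : L1 u ->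
  (forall psi, test_fun psi -> - S1int (fun x => u x * derive1 psi x)
     - 2 * (m0 * psi 0 - m1 * psi pi) = 0) ->
  m0 = m1 /\ exists s, {ae mu, forall x, S1 x -> u x = m0 * lam x + s}.
Proof.
move=> Lu eqn.
have m01 : m0 = m1.
  (* The constant test function removes the integral and leaves the balance of the two jumps. *)
  have := eqn _ test_cst1; rewrite derive1_cst1.
  rewrite (@S1int_ext _ _ (fun=> 0)) ?S1int_0; first lra.
  by move=> x; rewrite mulr0.
split=> //.
have Lm : L1 (fun x => u x - m0 * lam x) by apply: L1B => //; exact/L1Z/L1_lam.
have [|s us] := du_bois_reymond Lm.
  move=> psi tpsi; have := eqn _ tpsi.
  have [s1 _] := smooth_derive1 tpsi.1; have c1 := smooth_continuous s1.
  rewrite (@S1int_ext _ (fun x => (u x - m0 * lam x) * derive1 psi x)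
    (fun x => u x * derive1 psi x - m0 * (lam x * derive1 psi x))); last by move=> x; ring.
  have Ll := L1M L1_lam c1.
  rewrite (S1intB (L1M Lu c1) (L1Z m0 Ll)) (S1intZ _ Ll) S1int_lam_derive// -m01.
  lra.
exists s; move: us; apply: filterS; first exact: (ae_filter_ringOfSetsType mu).
by move=> x ux Sx; rewrite -(ux Sx); ring.
Qed.

Lemma S1_min f : continuous f ->
  exists2 x0, S1 x0 & forall x, S1 x -> f x0 <= f x.
Proof.
move=> cf; have pp : - pi <= pi :> R by rewrite ge0_cp// pi_ge0.
have [x0 Sx0 min0] := EVT_min pp (continuous_subspaceT cf).
by exists x0; [exact: Sx0|move=> x Sx; exact: min0].
Qed.

Lemma S1int_gt0 f : continuous f -> (forall x, 0 < f x) -> 0 < S1int f.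
Proof.
move=> cf f0; have [x0 Sx0 min0] := S1_min cf.
have Lc : L1 (fun _ : R => f x0) by apply: continuous_L1 => x; exact: cvg_cst.
apply: lt_le_trans (S1int_le Lc (continuous_L1 cf) min0).
by rewrite S1int_cst mulr_gt0// mulr_gt0// pi_gt0.
Qed.

(** Multiplying the flux identity by 2 N and integrating gives 0 = 2 m int(lambda N) + 2 s
    int(N). *)
Lemma flux_constant (N w1 : R -> R) (m s : R) : continuous N -> (forall x, 0 < N x) ->
  L1 w1 -> S1int w1 = 0 ->
  {ae mu, forall x, S1 x -> w1 x / (2 * N x) = m * lam x + s} ->
  s = m * gammaN N.
Proof.
move=> cN N0 Lw w0 ae1.
have LlN : L1 (fun x => lam x * N x) by exact: L1M L1_lam cN.
have LN := continuous_L1 cN.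
have IN := S1int_gt0 cN N0.
have : S1int w1 = 2 * m * S1int (fun x => lam x * N x) + 2 * s * S1int N.
  rewrite -!S1intZ// -S1intD; [|exact: L1Z..].
  apply: S1int_ae.
  - exact: L1_measurable.
  - by apply: L1_measurable; apply: L1D; exact: L1Z.
  - move: ae1; apply: filterS; first exact: (ae_filter_ringOfSetsType mu).
    move=> x /[swap] Sx /(_ Sx) wx.
    have Nx : N x != 0 by rewrite gt_eqF.
    have -> : w1 x = (w1 x / (2 * N x)) * (2 * N x).
      by rewrite divfK// mulf_neq0.
    by rewrite wx; ring.
rewrite w0 /gammaN => /esym; set A := S1int _; set B := S1int N in IN * => e.
have B0 : B != 0 by rewrite gt_eqF.
apply: (mulIf B0); rewrite -mulrA mulNr divfK//; lra.
Qed.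

(** Lets phi^(-q-1) be factored out of every nonlinear term of the first equation. *)
Lemma powR_split (y q : R) : 0 < y ->
  y `^ (q - 1) = (y `^ q) ^+ 2 * y `^ (- q - 1).
Proof.
move=> y0; rewrite expr2 -!powRD; first by congr (_ `^ _); ring.
- by apply/implyP => _; rewrite gt_eqF.
- by apply/implyP => _; rewrite gt_eqF.
Qed.

Lemma kappa_gt0 n : (3 <= n)%N -> 0 < @kappa R n.
Proof.
move=> n3; have : 3 <= n%:R :> R by rewrite ler_nat.
by rewrite /kappa => ?; rewrite divr_gt0//; lra.
Qed.

Lemma qexp_gt0 n : (3 <= n)%N -> 0 < @qexp R n.
Proof.
move=> n3; have : 3 <= n%:R :> R by rewrite ler_nat.
by rewrite /qexp => ?; rewrite divr_gt0//; lra.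
Qed.

Lemma no_solution (n : nat) (N : R -> R) (eta : R) (phi w : R -> R) :
  (3 <= n)%N -> smooth N -> (forall x, 0 < N x) -> eta != 0 ->
  ~ is_solution n N eta 0 (gammaN N) phi w.
Proof.
move=> n3 sN N0 eta0 [p [p1 [pphi [_ [cphi [phi0 [_ [_ [phi1 [phi2 [w1 [_ [_ [_ [_ [Lphi2
  [Lw1 [wd1 [wd2 [wdw [ode dist]]]]]]]]]]]]]]]]]]]]].
have k0 := kappa_gt0 n3; have q0 := qexp_gt0 n3.
move: ode dist; set k := kappa R n in k0 *; set q := qexp R n in q0 *.
set t := gammaN N => ode dist.
have {}Lphi2 := Lp_L1 p1 Lphi2; have {}Lw1 := Lp_L1 p1 Lw1.
have cN := smooth_continuous sN.
have Lu : L1 (fun x => w1 x / (2 * N x)).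
  apply: L1M => // x; apply: cvgV; first by rewrite gt_eqF// mulr_gt0.
  by apply: cvgM; [exact: cvg_cst|exact: cN].
have [m01 [s us]] := jump_equation Lu dist.
have w0 : S1int w1 = 0.
  have := wdw _ test_cst1; rewrite derive1_cst1.
  rewrite (@S1int_ext _ _ (fun=> 0)) ?S1int_0; last by move=> x; rewrite mulr0.
  rewrite (@S1int_ext _ (fun x => w1 x * 1) w1); last by move=> x; rewrite mulr1.
  lra.
have sE := flux_constant cN N0 Lw1 w0 us.
set M := phi 0 `^ q in us sE m01 *.
pose P x := phi x `^ (- q - 1).
have P0 x : 0 < P x by exact: powR_gt0.
have cP : continuous P by exact: continuous_powR.
(* The first equation solved for phi''. The parameter [T] stands for tau, which takes only the
   values t - 1 and t + 1, so that [G] is continuous for each fixed [T]. *)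
pose G T x := - (P x / (2 * k * q)) *
  (2 * eta ^+ 2 + k * T ^+ 2 * (M ^+ 2 - (phi x `^ q) ^+ 2)).
have kq0 : k * q != 0 by rewrite mulf_neq0// gt_eqF.
have cG T : continuous (G T).
  have cc (c : R) : continuous (fun _ : R => c) by move=> x; exact: cvg_cst.
  have cq : continuous (fun x => phi x `^ q) by exact: continuous_powR.
  move=> x; apply: cvgM; first by apply: cvgN; apply: cvgM; [exact: cP|exact: cc].
  apply: cvgD; first exact: cc.
  apply: cvgM; first exact: cc.
  apply: cvgB; first exact: cc.
  by rewrite expr2; apply: cvgM; exact: cq.
have LG : L1 (fun x => G (tau t x) x).
  apply: (L1_pw (cG (t + -1)) (cG (t + 1))).
    by move=> x /lam_neg; rewrite /tau => ->.
  by move=> x /lam_pos; rewrite /tau => ->.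
(* The maximum principle asks for a bound at every point, whereas [phi2] is controlled only almost
   everywhere; [G] replaces it under the integral. *)
have phi2G : {ae mu, forall x, S1 x -> phi2 x = G (tau t x) x}.
  move: us ode; apply: filterS2; first exact: (ae_filter_ringOfSetsType mu).
  move=> x ux ode Sx; have := ode Sx.
  rewrite (ux Sx) sE powR_split// /G -/(P x) -/t add0r.
  rewrite (_ : M * lam x + M * t = M * tau t x); last by rewrite /tau; ring.
  move: (tau t x) (P x) (phi x `^ q) (phi2 x) => T Px Q y e.
  have k0' : k != 0 by rewrite gt_eqF.
  have q0' : q != 0 by rewrite gt_eqF.
  have -> : y = (2 * k * q * y) / (2 * k * q) by field; rewrite k0' q0'.
  rewrite (_ : 2 * k * q * y = - Px * (2 * eta ^+ 2 + k * T ^+ 2 * (M ^+ 2 - Q ^+ 2))); last first.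
    by move: e; lra.
  by ring.
have [x0 Sx0 min0] := S1_min cphi.
have [xP SxP minP] := S1_min cP.
(* Since |tau| <= |t| + 1, an excess of phi^(2q) over M^2 by at most [beta] costs no more than
   eta^2, half of the term 2 eta^2 in [G]. *)
pose beta := eta ^+ 2 / (k * (`|t| + 1) ^+ 2).
have eta2 : 0 < eta ^+ 2 by rewrite exprn_even_gt0.
have t1 : 0 < `|t| + 1 by rewrite ltr_wpDl.
have kt : 0 < k * (`|t| + 1) ^+ 2 by rewrite mulr_gt0// exprn_gt0.
have beta0 : 0 < beta by rewrite divr_gt0.
(* Chosen so that phi < r means phi^(2q) < M^2 + beta. The minimum of phi lies below [r] because it
   is at most phi 0, and (phi 0)^q = M. *)
pose r := Num.sqrt (M ^+ 2 + beta) `^ q^-1.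
have M0 : 0 < M by exact: powR_gt0.
have qV y : 0 <= y -> (y `^ q^-1) `^ q = y.
  by move=> y0; rewrite -powRrM mulVf ?powRr1// gt_eqF.
have rq : r `^ q = Num.sqrt (M ^+ 2 + beta) by rewrite qV// sqrtr_ge0.
have kq : 0 < 2 * k * q by rewrite mulr_gt0// mulr_gt0.
have S0 : @S1 R 0 by rewrite in_S1 oppr_le0 pi_ge0.
have Mr : M < Num.sqrt (M ^+ 2 + beta).
  by rewrite -[ltLHS]ger0_norm ?(ltW M0)// -sqrtr_sqr ltr_sqrt ?ltrDl// addr_gt0// exprn_gt0.
apply: (@no_strictly_superharmonic_minimum R phi (fun x => G (tau t x) x) x0 r
  (P xP * eta ^+ 2 / (2 * k * q)) cphi pphi LG _ Sx0 min0).
- move=> psi tpsi; rewrite wd1; last exact: test_derive1.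
  rewrite wd2// opprK; have cpsi := smooth_continuous tpsi.1.
  apply: S1int_ae; [exact: (L1_measurable (L1M Lphi2 cpsi))|exact: (L1_measurable (L1M LG cpsi))|].
  move: phi2G; apply: filterS; first exact: (ae_filter_ringOfSetsType mu).
  by move=> x e Sx; rewrite e.
- rewrite ltNge; apply/negP => rphi.
  have : r `^ q <= M.
    apply: ge0_ler_powR; rewrite ?nnegrE ?powR_ge0 ?(ltW q0) ?(ltW (phi0 _))//.
    exact: le_trans rphi (min0 _ S0).
  by rewrite rq leNgt Mr.
- by apply: divr_gt0 => //; exact: mulr_gt0.
move=> x Sx xr.
have phiq : (phi x `^ q) ^+ 2 <= M ^+ 2 + beta.
  have h : phi x `^ q <= Num.sqrt (M ^+ 2 + beta).
    by rewrite -rq; apply: ge0_ler_powR;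
      rewrite ?nnegrE ?powR_ge0 ?(ltW q0) ?(ltW (phi0 _)) ?(ltW xr).
  rewrite -[leRHS]sqr_sqrtr; last by rewrite addr_ge0 ?sqr_ge0 ?(ltW beta0).
  by rewrite lerXn2r// nnegrE ?powR_ge0 ?sqrtr_ge0.
have tau2 : tau t x ^+ 2 <= (`|t| + 1) ^+ 2.
  rewrite -real_normK ?num_real// lerXn2r ?nnegrE ?(ltW t1)//.
  apply: (le_trans (ler_normD _ _)); rewrite lerD2l /lam.
  by case: ifP => _; rewrite ?normrN1 ?normr1.
have kb : k * tau t x ^+ 2 * ((phi x `^ q) ^+ 2 - M ^+ 2) <= eta ^+ 2.
  apply: (@le_trans _ _ (k * tau t x ^+ 2 * beta)).
    apply: ler_wpM2l; first exact: mulr_ge0 (ltW k0) (sqr_ge0 _).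
    by rewrite lerBlDl.
  apply: (@le_trans _ _ (k * (`|t| + 1) ^+ 2 * beta)).
    by apply: ler_wpM2r; [exact: ltW|apply: ler_wpM2l => //; exact: ltW].
  by rewrite /beta mulrC divfK// gt_eqF.
rewrite /G mulNr lerN2 [leRHS]mulrAC; apply: ler_wpM2r.
  by rewrite invr_ge0 ltW.
apply: ler_pM; rewrite ?(ltW (P0 _)) ?(ltW eta2) ?minP//; lra.
Qed.

End System.

(** * The constant solutions when eta and mu vanish *)

Section Existence.
Variable R : realType.
Implicit Types f g h : R -> R.
Local Notation mu := (@lebesgue_measure R).

(* [acos (cos x) = `|x|] on [- pi, pi]. *)
Definition reduce (x : R) := lam x * acos (cos x).

Lemma reduce_id x : - pi < x < pi -> reduce x = x.
Proof.
move=> /andP[x1 x2]; rewrite /reduce.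
have [x0|x0|->] := ltgtP x 0.
- by rewrite lam_neg ?x1// cosKN ?(ltW x1) ?(ltW x0)//; ring.
- by rewrite lam_pos ?x0// cosK ?mul1r// in_itv/= (ltW x0) (ltW x2).
- by rewrite cos0 acos1 mulr0.
Qed.

Lemma periodic_lam : periodic2pi (@lam R).
Proof. by move=> x; rewrite /lam (salg_periodic (salg_sin R)). Qed.

Lemma periodic_reduce : periodic2pi reduce.
Proof.
by move=> x; rewrite /reduce periodic_lam (salg_periodic (salg_cos R)).
Qed.

Lemma weak_deriv_cst (c : R) : weak_deriv (fun=> c) (fun=> 0).
Proof.
move=> psi tpsi; have [s1 _] := smooth_derive1 tpsi.1.
rewrite S1intZ ?(S1int_test_derive tpsi) ?mulr0; last first.
  exact/continuous_L1/smooth_continuous.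
rewrite (@S1int_ext _ _ (fun=> 0)) ?S1int_0 ?oppr0// => x; exact: mul0r.
Qed.

Lemma Lp_cst (p c : R) : 0 <= p -> Lp p (fun=> c).
Proof. by move=> p0; apply: (Lp_bounded (M := `|c|)) => //; exact: measurable_cst. Qed.

Lemma Lp_pw p f f1 f2 : 0 <= p -> continuous f1 -> continuous f2 ->
  (forall x, - pi < x < 0 -> f x = f1 x) -> (forall x, 0 < x < pi -> f x = f2 x) ->
  Lp p f.
Proof.
move=> p0 c1 c2 e1 e2; have [M _ fM] := bounded_pw c1 c2 e1 e2.
exact: Lp_bounded p0 (measurable_pw c1 c2 e1 e2) fM.
Qed.

(** Integration by parts on each arc; the boundary terms cancel because the two pieces agree at 0
    and at the point where - pi and pi are identified. *)
Lemma weak_deriv_pw f g f1 f2 g1 g2 :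
  continuous g1 -> continuous g2 ->
  (forall x, is_derive x (1 : R) f1 (g1 x)) ->
  (forall x, is_derive x (1 : R) f2 (g2 x)) ->
  (forall x, - pi < x < 0 -> f x = f1 x) -> (forall x, 0 < x < pi -> f x = f2 x) ->
  (forall x, - pi < x < 0 -> g x = g1 x) -> (forall x, 0 < x < pi -> g x = g2 x) ->
  f1 0 = f2 0 -> f1 (- pi) = f2 pi -> weak_deriv f g.
Proof.
move=> cg1 cg2 d1 d2 ef1 ef2 eg1 eg2 f0 fpi psi [spsi ppsi].
have [s1 dpsi] := smooth_derive1 spsi.
have cpsi := smooth_continuous spsi; have cdpsi := smooth_continuous s1.
have cf1 := derive_continuous d1; have cf2 := derive_continuous d2.
have Lfd := L1M (L1_pw cf1 cf2 ef1 ef2) cdpsi.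
have Lgp := L1M (L1_pw cg1 cg2 eg1 eg2) cpsi.
apply/eqP; rewrite -addr_eq0 -S1intD//; apply/eqP.
rewrite (@S1int_pw_derive _ _ (fun x => f1 x * derive1 psi x + psi x * g1 x)
  (fun x => f2 x * derive1 psi x + psi x * g2 x)
  (fun x => f1 x * psi x) (fun x => f2 x * psi x)).
- have -> : psi pi = psi (- pi) by rewrite -(ppsi (- pi)); congr psi; ring.
  by rewrite f0 fpi; ring.
- by move=> x; apply: cvgD; apply: cvgM; [exact: cf1|exact: cdpsi|exact: cpsi|exact: cg1].
- by move=> x; apply: cvgD; apply: cvgM; [exact: cf2|exact: cdpsi|exact: cpsi|exact: cg2].
- by move=> x x0; rewrite ef1// eg1//; ring.
- by move=> x x0; rewrite ef2// eg2//; ring.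
Qed.

Lemma constant_solution (n : nat) (N : R -> R) (c : R) :
  (3 <= n)%N -> smooth N -> periodic2pi N -> (forall x, 0 < N x) -> 0 < c ->
  exists w, is_solution n N 0 0 (gammaN N) (fun=> c) w.
Proof.
move=> n3 sN pN N0 c0; set t := gammaN N.
have cN := smooth_continuous sN.
have [G dG] := has_primitive cN.
pose C := c `^ qexp R n.
(* Primitives of 2 N C tau on the two arcs, normalized to vanish at - pi and at pi, so that they
   match there automatically. *)
pose W1 x := 2 * C * (t - 1) * (G x - G (- pi)).
pose W2 x := 2 * C * (t + 1) * (G x - G pi).
pose w x := let y := reduce x in if y < 0 then W1 y else W2 y.
pose w1 x := 2 * N x * (C * tau t x).
pose g1 x := 2 * C * (t - 1) * N x.
pose g2 x := 2 * C * (t + 1) * N x.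
have cc (a : R) : continuous (fun _ : R => a) by move=> x; exact: cvg_cst.
have cg1 : continuous g1 by move=> x; apply: cvgM; [exact: cc|exact: cN].
have cg2 : continuous g2 by move=> x; apply: cvgM; [exact: cc|exact: cN].
have dW a b x : is_derive x (1 : R) (fun y => a * (G y - b)) (a * N x).
  by apply: is_deriveZ; rewrite -[X in is_derive _ _ _ X]subr0; apply: is_deriveB.
have dW1 x : is_derive x (1 : R) W1 (g1 x) by exact: dW.
have dW2 x : is_derive x (1 : R) W2 (g2 x) by exact: dW.
have ew1 x : - pi < x < 0 -> w x = W1 x.
  move=> /andP[x1 x2]; rewrite /w reduce_id ?x1 ?x2//=.
  by rewrite (lt_trans x2)// pi_gt0.
have ew2 x : 0 < x < pi -> w x = W2 x.
  move=> /andP[x1 x2]; rewrite /w reduce_id ?x2 ?andbT /=; first by rewrite ltNge ltW.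
  by rewrite (lt_trans _ x1)// oppr_lt0 pi_gt0.
have eg1 x : - pi < x < 0 -> w1 x = g1 x.
  by move=> /lam_neg lx; rewrite /w1 /tau lx /g1; ring.
have eg2 x : 0 < x < pi -> w1 x = g2 x.
  by move=> /lam_pos lx; rewrite /w1 /tau lx /g2; ring.
(* Matching at 0 says that 2 N C tau has mean zero, which is exactly the condition t = gamma_N. *)
have W0 : W1 0 = W2 0.
  have IN := S1int_gt0 cN N0.
  have : t * S1int N = - S1int (fun x => lam x * N x).
    by rewrite /t /gammaN mulNr divfK// gt_eqF.
  rewrite (S1int_derive cN dG).
  rewrite (@S1int_pw_derive _ _ (fun x => -1 * N x) N (fun x => -1 * G x) G) //.
  - rewrite /W1 /W2 => H.
    have -> : 2 * C * (t - 1) * (G 0 - G (- pi)) = 2 * C * (t + 1) * (G 0 - G pi) +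
      2 * C * (t * (G pi - G (- pi)) + (- 1 * G 0 - - 1 * G (- pi) + (G pi - G 0))) by ring.
    by rewrite H; ring.
  - by move=> x; apply: cvgM; [exact: cc|exact: cN].
  - by move=> x /lam_neg ->.
  - by move=> x /lam_pos ->; rewrite mul1r.
have pw : periodic2pi w by move=> x; rewrite /w periodic_reduce.
have pw1 : periodic2pi w1 by move=> x; rewrite /w1 /tau pN periodic_lam.
have z2 : 0 <= 2 :> R by [].
have w1N x : w1 x / (2 * N x) = C * tau t x.
  by rewrite /w1 mulrC mulKf// mulf_neq0// gt_eqF.
(* Any exponent above 1 would do, as all the functions involved are bounded on the circle. *)
exists w, 2; split; first by rewrite ltr1n.
split; first by [].
split; first by [].
split; first exact: cc.
split; first by [].
split; first exact: Lp_cst.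
split; first exact: Lp_pw z2 (derive_continuous dW1) (derive_continuous dW2) ew1 ew2.
exists (fun=> 0), (fun=> 0), w1; do 3 (split; first by []).
do 2 (split; first exact: Lp_cst).
split; first exact: Lp_pw z2 cg1 cg2 eg1 eg2.
do 2 (split; first exact: weak_deriv_cst).
split.
  by apply: (weak_deriv_pw cg1 cg2 dW1 dW2 ew1 ew2 eg1 eg2 W0); rewrite /W1 /W2 !subrr !mulr0.
split.
  (* With phi'' = 0 and w' / (2 N) = C tau, the two remaining terms are opposite, as phi^(q-1) = C^2
     phi^(-q-1). *)
  apply: aeW => x _; rewrite w1N powR_split// -/C; ring.
move=> psi tpsi; have [spsi ppsi] := tpsi.
have [s1 dpsi] := smooth_derive1 spsi.
have c1 := smooth_continuous s1.
rewrite (@S1int_ext _ _ (fun x => C * t * derive1 psi x + C * (lam x * derive1 psi x))); last first.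
  by move=> x; rewrite w1N /tau; ring.
have L1d := continuous_L1 c1; have L1l := L1M (L1_lam R) c1.
rewrite (S1intD (L1Z _ L1d) (L1Z _ L1l)) (S1intZ _ L1d) (S1intZ _ L1l).
rewrite S1int_lam_derive// S1int_test_derive// -/C; ring.
Qed.

End Existence.

Theorem theorem3p2 (R : realType) (n : nat) (N : R -> R) (eta mu t : R) :
  (3 <= n)%N ->
  smooth N -> periodic2pi N -> (forall x, 0 < N x) ->
  t = gammaN N ->
  ((mu = 0 /\ eta = 0) ->
     exists F : R -> (R -> R) * (R -> R),
       (forall c, 0 < c -> is_solution n N eta mu t (F c).1 (F c).2) /\
       (forall c1 c2, 0 < c1 -> 0 < c2 -> c1 <> c2 ->
          exists x, (F c1).1 x <> (F c2).1 x)) /\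
  ((mu = 0 /\ eta <> 0) ->
     ~ exists phi w : R -> R, is_solution n N eta mu t phi w).
Proof.
move=> n3 sN pN N0 ->; split=> [[-> ->]|[-> eta0]]; last first.
  by move=> [phi [w]]; apply: no_solution => //; exact/eqP.
have /choice[W WP] : forall c : R, exists w, 0 < c ->
    is_solution n N 0 0 (gammaN N) (fun=> c) w.
  (* The parameter of the family is the constant value of phi; for c <= 0 the chosen function is a
     dummy. *)
  move=> c; have [c0|c0] := ltP 0 c; last by exists (fun=> 0).
  by have [w sw] := constant_solution n3 sN pN N0 c0; exists w.
exists (fun c => (fun=> c, W c)); split=> [c /WP //|c1 c2 _ _ c12].
by exists 0.
Qed.
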